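(* Let $Y$ be a topological vector space and let $A$ be a closed proper subset of $Y$. Let $k\in Y\setminus\{0\}$. The following conditions are equivalent: (a) $A-\mathbb{R}_{>}k\subseteq\operatorname{int}A$. (b) $A-\mathbb{R}_{>}k=\operatorname{int}A$. (c) $A-(C\setminus\{0\})=\operatorname{int}A$ for some non-trivial convex cone $C\subset Y$ with $k\in C$. (d) $A-(C\setminus\{0\})=\operatorname{int}A$ for some non-trivial cone $C\subset Y$ with $k\in C$. If $Y$ is a Hausdorff space, then these conditions are equivalent to (e) $A-(C\setminus\{0\})=\operatorname{int}A$ for some non-trivial closed convex cone $C\subset Y$ with $k\in C$.
   Context: Vector spaces are real; $\mathbb{R}_{>}=\{t\in\mathbb{R}\mid t>0\}$ and $\mathbb{R}_{>}k=\{tk\mid t>0\}$. ''Proper subset of $Y$'' means nonempty and different from $Y$. A set $C$ is a cone if $\lambda c\in C$ for all $\lambda\ge0$, $c\in C$; it is non-trivial if $C\neq\{0\}$ and $C\neq Y$. Topological vector spaces are not assumed to be Hausdorff unless stated. $\operatorname{int}$ is the topological interior. *)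

(* Defs.v *)
From HB Require Import structures.
From mathcomp Require Import all_boot all_order all_algebra.
From mathcomp Require Import all_classical all_reals all_analysis.
Set Implicit Arguments.
Unset Strict Implicit.
Unset Printing Implicit Defensive.
Import Order.TTheory GRing.Theory Num.Theory.
Import numFieldNormedType.Exports.
Local Open Scope classical_set_scope.
Local Open Scope ring_scope.

(* Real topological vector spaces are rendered as [topologicalLmodType R] with
   [R : realType]: addition and scaling are jointly continuous, and neither
   separation nor local convexity is assumed ([tvsType R] is locally convex). *)

Definition set_sub (V : zmodType) (A B : set V) : set V :=
  [set a - b | a in A & b in B].

Definition open_ray (R : realType) (V : lmodType R) (k : V) : set V :=
  [set t *: k | t in [set t : R | 0 < t]].

(* A nonempty cone contains 0; no convexity is required. *)
Definition is_cone (R : realType) (V : lmodType R) (C : set V) : Prop :=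
  forall (l : R) (c : V), 0 <= l -> C c -> C (l *: c).

Definition nontrivial_cone (R : realType) (V : lmodType R) (C : set V) : Prop :=
  [/\ is_cone C, C <> [set 0] & C <> setT].

(* Main.v *)
Require Import Defs.
From HB Require Import structures.
From mathcomp Require Import all_boot all_order all_algebra.
From mathcomp Require Import all_classical all_reals all_analysis.
Set Implicit Arguments.
Unset Strict Implicit.
Unset Printing Implicit Defensive.
Import Order.TTheory GRing.Theory Num.Theory.
Import numFieldNormedType.Exports.
Local Open Scope classical_set_scope.
Local Open Scope ring_scope.

(** Moving from an interior point [x] of [A] a little way along [k] stays in
    [A], and subtracting that displacement returns to [x]; so the inclusion of
    [interior A] in [set_sub A (open_ray k)] always holds, and (a) and (b)
    differ only by it ([interior_sub_ray]).

    One witness serves for every existential condition: the closed ray spanned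
    by [k]. It is a non-trivial convex cone whose nonzero part is exactly
    [open_ray k] ([closed_rayD0]), so for it the cone condition is (b) itself.
    Conversely a cone containing [k] contains the whole ray
    ([open_ray_sub_cone]), so each cone condition gives back (a).

    What remains for (e) is that the closed ray is closed in a Hausdorff space
    ([closed_closed_ray]). Continuity of scaling at the pair (0, y) shows that
    near [y] the ray only has points with bounded parameter; locally it is thus
    the continuous image of a segment, which is compact and hence closed. *)

Definition closed_ray (R : realType) (V : lmodType R) (k : V) : set V :=
  [set t *: k | t in [set t : R | 0 <= t]].

Lemma closed_rayD0 (R : realType) (V : lmodType R) (k : V) :
  k <> 0 -> closed_ray k `\ 0 = open_ray k.
Proof.
move=> k0; apply/seteqP; split=> [_ [[t /= t0 <-] tk]|_ [t /= t0 <-]].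
  exists t => //=; rewrite lt_neqAle t0 andbT; apply/eqP => tE.
  by apply: tk; rewrite -tE scale0r.
split; first by exists t => //=; exact: ltW.
by move/eqP; rewrite scaler_eq0 gt_eqF//= => /eqP.
Qed.

Lemma closed_ray_id (R : realType) (V : lmodType R) (k : V) : closed_ray k k.
Proof. by exists 1; rewrite ?scale1r//=. Qed.

(** The ray is not the whole space because it misses [- k]. *)
Lemma closed_ray_nontrivial (R : realType) (V : lmodType R) (k : V) :
  k <> 0 -> nontrivial_cone (closed_ray k).
Proof.
move=> k0; split.
- move=> l _ l0 [t /= t0 <-]; exists (l * t); last by rewrite scalerA.
  by rewrite /= mulr_ge0.
- by move=> ray0; have := closed_ray_id k; rewrite ray0.
- move=> rayT; have : closed_ray k (- k) by rewrite rayT.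
  case=> t /= t0 /eqP; rewrite -addr_eq0 -[X in _ + X]scale1r -scalerDl.
  rewrite scaler_eq0 => /orP[|/eqP//]; rewrite gt_eqF//.
  exact: ltr_wpDl.
Qed.

Lemma closed_ray_convex (R : realType) (V : lmodType R) (k : V) :
  convex_set (closed_ray k).
Proof.
apply/convex_setW => _ _ /set_mem[s /= s0 <-] /set_mem[t /= t0 <-] l l0 l1.
apply/mem_set; exists (l%:num * s + (1 - l%:num) * t).
  by rewrite /= addr_ge0// mulr_ge0// subr_ge0.
by rewrite scalerDl -!scalerA.
Qed.

Lemma scalel_continuous (R : realType) (Y : topologicalLmodType R) (y : Y) :
  continuous (fun t : R => t *: y).
Proof.
move=> t.
apply: (@continuous_comp R (R^o * Y)%type Y (fun s => (s, y))
  (fun z => z.1 *: z.2)); last exact: scale_continuous.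
by apply: (@cvg_pair _ _ _ _ (nbhs (t : R^o))); [exact: cvg_id|exact: cvg_cst].
Qed.

(** If points [t *: k] with [t] arbitrarily large came close to [y], then
    [k = t^-1 *: (t *: k)] would be close to [0 *: y = 0], whereas separation
    keeps [k] away from 0. *)
Lemma closed_closed_ray (R : realType) (Y : topologicalLmodType R) (k : Y) :
  hausdorff_space Y -> k <> 0 -> closed (closed_ray k).
Proof.
move=> hY k0 y yray.
have W0 : nbhs (0 : Y) (~` [set k]).
  apply: open_nbhs_nbhs; split; last by move=> /= /esym.
  by rewrite openC; exact/accessible_closed_set1/hausdorff_accessible.
have := @scale_continuous R Y (0, y) (~` [set k]).
rewrite /= scale0r => /(_ W0)[[B N] [/= B0 Ny] BN].
have [d /= d0 dB] : exists2 d : R, 0 < d & forall s : R, `|s| < d -> B s.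
  case: B0 => d /= d0 dB; exists d => // s sd.
  by apply: dB; rewrite /= sub0r normrN.
have bounded t : 0 <= t -> N (t *: k) -> t <= d^-1.
  move=> t0 Nt; rewrite leNgt; apply/negP => dt.
  have tp : 0 < t by rewrite (lt_trans _ dt)// invr_gt0.
  apply: (BN (t^-1, t *: k)) => /=; last first.
    by rewrite scalerA mulVf ?scale1r// gt_eqF.
  split=> //=; apply: dB; rewrite gtr0_norm ?invr_gt0//.
  by rewrite invf_plt.
have segment_closed : closed ((fun t : R => t *: k) @` `[0, d^-1]).
  apply: compact_closed => //.
  apply: continuous_compact; last exact: segment_compact.
  by apply: continuous_subspaceT; exact: scalel_continuous.
suff [t /=] : ((fun t : R => t *: k) @` `[0, d^-1]) y.
  by rewrite in_itv/= => /andP[t0 _] <-; exists t.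
apply: segment_closed => U Uy.
have [_ [[t /= t0 <-] [Ut Nt]]] := yray _ (filterI Uy Ny).
by exists (t *: k); split=> //; exists t => //=; rewrite in_itv/= t0/= bounded.
Qed.

(** An interior point [x] is [(x + t *: k) - t *: k], with [x + t *: k] in [A]
    as soon as [t] is small. *)
Lemma interior_sub_ray (R : realType) (Y : topologicalLmodType R)
    (A : set Y) (k : Y) :
  interior A `<=` set_sub A (open_ray k).
Proof.
move=> x Ax.
have : (fun t : R => x + t *: k) @ (0 : R) --> x.
  rewrite -[X in _ --> X]addr0 -(scale0r k).
  apply: (@continuous_comp R (Y * Y)%type Y (fun t : R => (x, t *: k))
    (fun z => z.1 + z.2)); last exact: add_continuous.
  by apply: cvg_pair; [exact: cvg_cst|exact: scalel_continuous].
(* [eA] concerns [`|t| < e]; halving [e] gives an admissible positive [t]. *)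
move=> /(_ _ Ax)[e /= e0 eA].
exists (x + (e / 2) *: k); last first.
  exists ((e / 2) *: k); last by rewrite addrK.
  by exists (e / 2) => //=; rewrite divr_gt0.
apply: eA; rewrite /= sub0r normrN gtr0_norm ?divr_gt0//.
by rewrite ltr_pdivrMr// ltr_pMr// ltr1n.
Qed.

Lemma open_ray_sub_cone (R : realType) (V : lmodType R) (C : set V) (k : V) :
  k <> 0 -> is_cone C -> C k -> open_ray k `<=` C `\ 0.
Proof.
move=> k0 Ccone Ck; rewrite -closed_rayD0// => _ [[t /= t0 <-] tk].
by split=> //; exact: Ccone.
Qed.

Theorem proposition9 (R : realType) (Y : topologicalLmodType R)
    (A : set Y) (k : Y)
    (A_closed : closed A) (A_nonempty : A !=set0) (A_neq_Y : A <> setT)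
    (k_neq0 : k <> 0) :
  [<-> (* (a) *) set_sub A (open_ray k) `<=` interior A;
       (* (b) *) set_sub A (open_ray k) = interior A;
       (* (c) *) exists C : set Y,
                   [/\ nontrivial_cone C, convex_set C, C k
                     & set_sub A (C `\ 0) = interior A];
       (* (d) *) exists C : set Y,
                   [/\ nontrivial_cone C, C k
                     & set_sub A (C `\ 0) = interior A] ]
  /\
  (hausdorff_space Y ->
     (set_sub A (open_ray k) `<=` interior A <->
      (* (e) *) exists C : set Y,
                  [/\ nontrivial_cone C, convex_set C, closed C, C k
                    & set_sub A (C `\ 0) = interior A])).
Proof.
have ab : set_sub A (open_ray k) `<=` interior A ->
    set_sub A (open_ray k) = interior A.
  by move=> a; apply/seteqP; split=> //; exact: interior_sub_ray.
have da (C : set Y) : nontrivial_cone C -> C k ->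
    set_sub A (C `\ 0) = interior A ->
    set_sub A (open_ray k) `<=` interior A.
  move=> [Ccone _ _] Ck <- _ [a Aa [b kb <-]].
  by exists a => //; exists b => //; exact: open_ray_sub_cone kb.
split.
  tfae.
  - exact: ab.
  - move=> b; exists (closed_ray k); rewrite closed_rayD0//; split=> //.
    + exact: closed_ray_nontrivial.
    + exact: closed_ray_convex.
    + exact: closed_ray_id.
  - by move=> [C [Cnt _ Ck CA]]; exists C.
  - by move=> [C [Cnt Ck CA]]; exact: da CA.
move=> hY; split=> [a|[C [Cnt _ _ Ck CA]]]; last exact: da CA.
exists (closed_ray k); rewrite closed_rayD0//; split.
- exact: closed_ray_nontrivial.
- exact: closed_ray_convex.
- exact: closed_closed_ray.
- exact: closed_ray_id.
- exact: ab.
Qed.
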